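(* For every integer $d \ge 3$ there is a constant $f(d)$ (depending only on $d$) such that for every $h \ge 1$ the partial order $\mathcal{T}^h$ has a $d$-hitting family of schedules of size at most $f(d)\, h^{d-1}$ (i.e. of size $O(h^{d-1})$, which is $O((\log n)^{d-1})$ where $n = 2^{h+1}-1$ is the number of elements of $\mathcal{T}^h$).
   Context: $\mathcal{T}^h$ is the partial order on the set $\{0,1\}^{\le h}$ of binary strings of length at most $h$, where $x \le y$ iff $x$ is a prefix of $y$ (the complete binary tree of height $h$). A schedule of a finite partial order $(P,\le)$ is a linear extension of it. A $d$-tuple $(a_1,\dots,a_d)$ of distinct elements of $P$ is admissible if for all $i<j$ either $a_i \le a_j$ or $a_i,a_j$ are incomparable. A schedule hits $(a_1,\dots,a_d)$ if its restriction to $\{a_1,\dots,a_d\}$ is the sequence $a_1,\dots,a_d$. A family of schedules is $d$-hitting if every admissible $d$-tuple is hit by some schedule in the family. *)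

(* Defs.v *)
From HB Require Import structures.
From mathcomp Require Import all_boot all_order.

Set Implicit Arguments.
Unset Strict Implicit.
Unset Printing Implicit Defensive.

Import Order.TTheory.

Section Schedules.
Variables (disp : Order.disp_t) (P : finPOrderType disp).

(* A linear extension is given by the sequence listing all elements of P,
   each exactly once, in increasing order. *)
Definition schedule (s : seq P) : Prop :=
  [/\ uniq s,
      (forall x : P, x \in s) &
      (forall x y : P, (x < y)%O -> index x s < index y s)].

Definition admissible (d : nat) (a : d.-tuple P) : Prop :=
  uniq a /\
  (forall i j : 'I_d, i < j ->
     (tnth a i <= tnth a j)%O \/ (tnth a i >< tnth a j)%O).

Definition hits (d : nat) (s : seq P) (a : d.-tuple P) : Prop :=
  [seq x <- s | x \in a] = a.

Definition hitting_family (d : nat) (F : seq (seq P)) : Prop :=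
  (forall s, s \in F -> schedule s) /\
  (forall a : d.-tuple P, admissible a -> exists2 s, s \in F & hits s a).

End Schedules.

Definition tree (h : nat) : predArgType := {bseq h of bool}.

HB.instance Definition _ (h : nat) := Finite.on (tree h).

Section TreeOrder.
Variable h : nat.

Definition tree_le (x y : tree h) : bool := prefix (bseqval x) (bseqval y).

Fact tree_le_refl : reflexive tree_le.
Proof. by move=> x; apply: prefix_refl. Qed.

Fact tree_le_anti : antisymmetric tree_le.
Proof.
move=> x y /andP[]; rewrite /tree_le => /prefixP[u yE] /prefixP[v xE].
apply: val_inj => /=; rewrite yE; move/(congr1 size): xE.
rewrite yE !size_cat -addnA -[LHS]addn0 => /addnI/esym/eqP.
by rewrite addn_eq0 => /andP[/nilP-> _]; rewrite cats0.
Qed.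

Fact tree_le_trans : transitive tree_le.
Proof. by move=> y x z; apply: prefix_trans. Qed.

End TreeOrder.

Fact tree_display : Order.disp_t. Proof. exact: (Order.Disp tt tt). Qed.

HB.instance Definition _ (h : nat) :=
  Order.Le_isPOrder.Build tree_display (tree h)
    (@tree_le_refl h) (@tree_le_anti h) (@tree_le_trans h).

Lemma tree_leE (h : nat) (x y : tree h) :
  (x <= y)%O = prefix (bseqval x) (bseqval y).
Proof. by []. Qed.

(* Main.v *)
Require Import Defs.
From mathcomp Require Import all_boot all_order.

(** The pairwise meets of [d] nodes of a tree lie on at most [d - 1] distinct
    levels, because the meet depth is an (inverted) ultrametric.  Fix levels
    [k_1, ..., k_(d-1)] containing those of [a_1, ..., a_d], and say that [w]
    passes the tests of [a_j] if [w] is at least as deep as [a_j] and turns the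
    same way as [a_j], as far as can be seen on the levels [k_t].  Passing is
    inherited by extensions of [w], and [a_i] passes the tests of [a_j] only if
    [a_j] is a prefix of [a_i], as their meet lies on a chosen level.  Hence
    [w |-> max {j | w passes the tests of a_j}] is monotone and maps [a_i] to
    [i], so that sorting by it gives a schedule hitting [(a_1, ..., a_d)].
    Besides the [d - 1] levels, the schedule depends only on the outcome of each
    test, that is, on data whose size is a function of [d] alone. *)

Set Implicit Arguments.
Unset Strict Implicit.
Unset Printing Implicit Defensive.

Import Order.TTheory.

(** * Depths of pairwise meets *)

Lemma seq_argmax (T : eqType) (f : T -> nat) (s : seq T) :
  s != [::] -> exists2 y, y \in s & {in s, forall z, f z <= f y}.
Proof.
elim: s => // x s IHs _; have [->|/IHs[y ys ymax]] := eqVneq s [::].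
  by exists x; rewrite ?mem_head // => z; rewrite inE => /eqP->.
have [le_xy|/ltnW le_yx] := leqP (f x) (f y).
  by exists y; rewrite ?inE ?ys ?orbT // => z; rewrite inE => /predU1P[->|/ymax].
exists x; rewrite ?mem_head // => z; rewrite inE => /predU1P[-> //|/ymax fz].
exact: leq_trans le_yx.
Qed.

Section CommonPrefix.
Variable T : eqType.
Implicit Types (x y z : seq T) (s : seq (seq T)).

Fixpoint lcp x y : nat :=
  match x, y with
  | a :: x', b :: y' => if a == b then (lcp x' y').+1 else 0
  | _, _ => 0
  end.

Lemma lcpC x y : lcp x y = lcp y x.
Proof.
elim: x y => [|a x IHx] [|b y] //=.
by rewrite eq_sym IHx.
Qed.

Lemma lcp_sizel x y : lcp x y <= size x.
Proof. by elim: x y => [|a x IHx] [|b y] //=; case: eqP => // _; apply: IHx. Qed.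

Lemma lcp_prefix x y : lcp x y = size x -> prefix x y.
Proof.
elim: x y => [|a x IHx] [|b y] //=; case: eqP => // _ [].
exact: IHx.
Qed.

Lemma nth_lcp_neq t0 x y :
  lcp x y < size x -> lcp x y < size y -> nth t0 x (lcp x y) != nth t0 y (lcp x y).
Proof.
elim: x y => [|a x IHx] [|b y] //=; case: eqVneq => [_|//] /=.
exact: IHx.
Qed.

(** Where [z] ends or parts from [x], the sequences [x] and [y] still agree. *)
Lemma lcp_ultrametric x y z : lcp x z < lcp x y -> lcp y z = lcp x z.
Proof.
elim: x y z => [|a x IHx] [|b y] [|c z] //=.
have [<-|//] := eqVneq a b; case: eqVneq => // _.
by rewrite ltnS => /IHx->.
Qed.

(** Prepending [x] adds a single level, that of its meet with a closest [y0]: any [y] meeting [x]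
    less deeply meets [y0] at that same depth, already in [K]. *)
Lemma lcp_levels s : exists K : seq nat,
  size K = (size s).-1 /\ {in s &, forall x y, x != y -> lcp x y \in K}.
Proof.
elim: s => [|x s [K [szK Klcp]]]; first by exists [::].
have [->|s_neq0] := eqVneq s [::].
  exists [::]; split=> // y z; rewrite !inE => /eqP-> /eqP->.
  by rewrite eqxx.
have [y0 y0s y0max] := seq_argmax (lcp x) s_neq0.
have new y : y \in s -> lcp x y \in lcp x y0 :: K.
  move=> ys; rewrite inE; case: ltngtP (y0max y ys) => //= lt_y _.
  rewrite -(lcp_ultrametric lt_y) Klcp //.
  by apply: contraTneq lt_y => ->; rewrite ltnn.
exists (lcp x y0 :: K); split; first by rewrite /= szK prednK // lt0n size_eq0.
move=> y z; rewrite !inE => /predU1P[->|ys] /predU1P[->|zs].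
- by rewrite eqxx.
- by move=> _; rewrite -in_cons new.
- by move=> _; rewrite lcpC -in_cons new.
by move=> y_neq_z; rewrite Klcp ?orbT.
Qed.

End CommonPrefix.

(** * Tests on a single level *)

Section LevelTests.
Implicit Types (x y : seq bool) (k : nat) (o : option (option bool)).

(* [Some (Some b)]: the path turns to [b] at level [k]; [Some None]: the path
   reaches level [k]; [None]: no condition. *)
Definition level_test o k x : bool :=
  match o with
  | Some (Some b) => (k < size x) && (nth false x k == b)
  | Some None => k <= size x
  | None => true
  end.

(** The strongest condition at level [k] that [x] satisfies. *)
Definition test_of x k : option (option bool) :=
  if k < size x then Some (Some (nth false x k))
  else if k == size x then Some None else None.

Lemma level_test_prefix o k x y :
  prefix x y -> level_test o k x -> level_test o k y.
Proof.
move=> /prefixP[z ->]; case: o => [[b|]|] //=; rewrite size_cat.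
  by case/andP=> lt_k /eqP<-; rewrite nth_cat lt_k eqxx andbT ltn_addr.
by move/leq_trans; apply; rewrite leq_addr.
Qed.

Lemma level_test_refl k x : level_test (test_of x k) k x.
Proof.
rewrite /test_of; case: ifP => [lt_k|_] /=; first by rewrite lt_k eqxx.
by case: eqP => //= ->.
Qed.

(** If [x] went on past the meet, [y] would have to take the same turn there, making the meet
    deeper; so [x] ends at the meet. *)
Lemma level_test_lcp x y :
  level_test (test_of x (lcp x y)) (lcp x y) y -> prefix x y.
Proof.
rewrite /test_of; have := lcp_sizel x y; case: ltngtP => //= [lt_x _|eq_x _ _].
  case/andP=> lt_y /eqP eq_nth.
  by have := nth_lcp_neq false lt_x lt_y; rewrite eq_nth eqxx.
exact: lcp_prefix.
Qed.

End LevelTests.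

(** * Schedules obtained by sorting *)

Section SortBy.
Variables (disp : Order.disp_t) (P : finPOrderType disp) (key : P -> nat).

Definition sort_by : seq P := sort (relpre key leq) (enum P).

Let key_trans : transitive (relpre key leq).
Proof. by move=> y x z; apply: leq_trans. Qed.

Let key_total : total (relpre key leq).
Proof. by move=> x y; apply: leq_total. Qed.

Lemma sort_by_sorted : sorted (relpre key leq) sort_by.
Proof. exact: sort_sorted. Qed.

Lemma mem_sort_by x : x \in sort_by.
Proof. by rewrite mem_sort mem_enum. Qed.

Lemma sort_by_uniq : uniq sort_by.
Proof. by rewrite sort_uniq enum_uniq. Qed.

Lemma sort_by_schedule :
  (forall x y : P, (x < y)%O -> key x < key y) -> schedule sort_by.
Proof.
move=> key_mono; split; [exact: sort_by_uniq | exact: mem_sort_by |].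
move=> x y /key_mono; apply: contraTT; rewrite -!leqNgt => le_yx.
apply: (sorted_leq_index key_trans _ sort_by_sorted) => //.
- by move=> z; apply: leqnn.
- exact: mem_sort_by.
- exact: mem_sort_by.
Qed.

(** The key is injective on the entries of [a], so they have only one arrangement sorted by it. *)
Lemma sort_by_hits d (a : d.-tuple P) :
  (forall i j : 'I_d, i < j -> key (tnth a i) < key (tnth a j)) ->
  hits sort_by a.
Proof.
move=> key_lt; have a_sorted : sorted (relpre key ltn) a.
  case: d a key_lt => [|d] a key_lt; first by rewrite tuple0.
  have x0 : P := tnth a ord0; apply/(sortedP x0) => i; rewrite size_tuple => lt_i /=.
  have := key_lt (Ordinal (ltnW lt_i)) (Ordinal lt_i) (leqnn _).
  by rewrite !(tnth_nth x0).
have a_uniq : uniq a.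
  apply: (sorted_uniq (leT := relpre key ltn)) => //.
    by move=> y x z; apply: ltn_trans.
  by move=> x /=; rewrite ltnn.
apply: (sorted_eq_in (leT := relpre key leq)).
- by move=> y x z _ _ _; apply: key_trans.
- move=> x y; rewrite !mem_filter => /andP[/tnthP[i ->] _] /andP[/tnthP[j ->] _].
  rewrite /= -eqn_leq => /eqP eq_key.
  by case: (ltngtP i j) => [/key_lt|/key_lt|/val_inj-> //]; rewrite eq_key ltnn.
- by apply: sorted_filter sort_by_sorted.
- by apply: sub_sorted a_sorted => x y /= /ltnW.
apply: uniq_perm => [||x]; rewrite ?filter_uniq ?sort_by_uniq //.
by rewrite mem_filter mem_sort_by andbT.
Qed.

End SortBy.

Lemma card_tree h : #|tree h| = 2 ^ (h + 1) - 1.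
Proof.
have -> : #|tree h| = #|{: {k : 'I_h.+1 & k.-tuple bool}}|.
  exact: bij_eq_card (@bseq_tagged_tuple_bij _ _).
rewrite card_tagged sumnE big_map big_enum /=.
under eq_bigr do rewrite card_tuple card_bool.
rewrite addn1 -(big_mkord predT (fun k => 2 ^ k)).
elim: h.+1 => [|n IHn]; first by rewrite big_geq.
by rewrite big_nat_recr //= IHn addnBAC ?expn_gt0 // addnn -mul2n -expnS.
Qed.

(** * Schedules from levels and tests *)

Section TestSchedules.
Variables h d e : nat.

(** The chosen levels, and the condition that each index of the tuple imposes at each of them. Only
    the levels range over a set that grows with [h]. *)
Definition code : finType :=
  ({ffun 'I_e -> 'I_h.+1} * {ffun 'I_d * 'I_e -> option (option bool)})%type.

Definition passes (c : code) (j : 'I_d) (w : tree h) : bool :=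
  [forall t, level_test (c.2 (j, t)) (c.1 t) w].

Definition phase (c : code) (w : tree h) : nat :=
  \max_(j < d | passes c j w) j.

(* Lexicographic in the phase, then the depth. *)
Definition phase_key (c : code) (w : tree h) : nat := phase c w * h.+1 + size w.

Lemma card_code : #|code| = h.+1 ^ e * 4 ^ (d * e).
Proof.
by rewrite card_prod !card_ffun card_prod !card_option card_bool !card_ord.
Qed.

Lemma phase_key_lt c (v w : tree h) : phase c v < phase c w ->
  phase_key c v < phase_key c w.
Proof.
move=> lt_vw; apply: (@leq_trans ((phase c v).+1 * h.+1)).
  by rewrite mulSnr ltn_add2l ltnS size_bseq.
by rewrite (leq_trans _ (leq_addr _ _)) // leq_mul2r lt_vw orbT.
Qed.

(** The phase cannot drop, since [w] passes every test that [v] passes; if it stays equal, the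
    greater depth of [w] decides. *)
Lemma phase_key_mono c (v w : tree h) : (v < w)%O ->
  phase_key c v < phase_key c w.
Proof.
rewrite lt_neqAle tree_leE => /andP[v_neq_w pre_vw].
have : phase c v <= phase c w.
  apply/bigmax_leqP => j pass_v; apply: (leq_bigmax_cond (P := passes c ^~ w)).
  by apply/forallP => t; apply: level_test_prefix pre_vw _; apply: (forallP pass_v).
rewrite leq_eqVlt => /predU1P[eq_ph|/phase_key_lt //].
rewrite /phase_key eq_ph ltn_add2l ltn_neqAle size_prefix // andbT.
apply: contraNneq v_neq_w => eq_size; apply/eqP/val_inj.
by move: pre_vw; rewrite prefixE eq_size take_size => /eqP.
Qed.

End TestSchedules.

Lemma phase_hits h d (a : d.-tuple (tree h)) : admissible a ->
  exists c : code h d d.-1, hits (sort_by (phase_key c)) a.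
Proof.
case=> a_uniq a_adm.
have [K [szK Klcp]] := lcp_levels (map (@bseqval h bool) a).
rewrite size_map size_tuple in szK.
(* Meet depths are at most [h], so [inord] leaves them unchanged. *)
pose level (t : 'I_d.-1) : 'I_h.+1 := inord (nth 0 K t).
exists ([ffun t => level t], [ffun jt => test_of (tnth a jt.1) (level jt.2)]).
set c := (_, _).
(* For [i < j], passing would put [tnth a j] strictly below [tnth a i], against admissibility. *)
have pass_le i j : passes c j (tnth a i) -> j <= i.
  move=> pass_ij; rewrite leqNgt; apply/negP => lt_ij.
  have a_neq : tnth a j != tnth a i.
    by have /tuple_uniqP/inj_eq-> := a_uniq; rewrite -val_eqE neq_ltn lt_ij orbT.
  have kK : lcp (tnth a j) (tnth a i) \in K.
    by apply: Klcp; rewrite ?map_f ?mem_tnth.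
  have lt_t : index (lcp (tnth a j) (tnth a i)) K < d.-1 by rewrite -szK index_mem.
  have level_t : level (Ordinal lt_t) = lcp (tnth a j) (tnth a i) :> nat.
    rewrite inordK nth_index // ltnS.
    by rewrite (leq_trans (lcp_sizel _ _)) // size_bseq.
  have /forallP/(_ (Ordinal lt_t)) := pass_ij.
  rewrite !ffunE /= level_t => /level_test_lcp; rewrite -tree_leE => le_ji.
  case: (a_adm i j lt_ij) => [le_ij|].
    by case/eqP: a_neq; apply: le_anti; rewrite le_ji.
  by rewrite /Order.comparable le_ji orbT.
have phase_a i : phase c (tnth a i) = i.
  apply/eqP; rewrite eqn_leq; apply/andP; split.
    by apply/bigmax_leqP => j; apply: pass_le.
  apply: (leq_bigmax_cond (P := passes c ^~ (tnth a i))).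
  by apply/forallP => t; rewrite !ffunE level_test_refl.
by apply: sort_by_hits => i j lt_ij; apply: phase_key_lt; rewrite !phase_a.
Qed.

Lemma trunc_log_card_tree h : trunc_log 2 #|tree h| = h.
Proof.
rewrite card_tree addn1 subn1; apply: trunc_log_eq => //.
rewrite prednK ?expn_gt0 // leqnn andbT -ltnS prednK ?expn_gt0 //.
by rewrite ltn_exp2l.
Qed.

Theorem theorem3 (d : nat) (hd : 3 <= d) :
  exists c : nat, forall h : nat, 1 <= h ->
    #|tree h| = 2 ^ (h + 1) - 1 /\
    exists F : seq (seq (tree h)),
      [/\ hitting_family d F,
          size F <= c * h ^ (d - 1) &
          size F <= c * trunc_log 2 #|tree h| ^ (d - 1)].
Proof.
(* The first factor counts the choices of conditions, four per index and level; the second absorbs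
   [h.+1 <= 2 * h]. *)
exists (4 ^ (d * d.-1) * 2 ^ d.-1) => h h_gt0; split; first exact: card_tree.
pose F := [seq sort_by (phase_key c) | c : code h d d.-1].
have size_F : size F <= 4 ^ (d * d.-1) * 2 ^ d.-1 * h ^ (d - 1).
  rewrite size_map -cardT card_code subn1 mulnC -mulnA leq_mul2l -expnMn.
  rewrite leq_exp2r; first by rewrite mul2n -addnn -[h.+1]add1n leq_add2r h_gt0 orbT.
  by case: (d) hd => [|[]].
exists F; split=> //; last by rewrite trunc_log_card_tree.
split=> [s /mapP[c _ ->]|a /phase_hits[c hit_c]].
  exact/sort_by_schedule/phase_key_mono.
by exists (sort_by (phase_key c)) => //; apply: map_f; rewrite mem_enum.
Qed.
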